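(* Let $K \in \mathbb{R}^{n\times n}$ be a rate constant matrix with stationary distribution $\pi \in \Delta_n^\circ$ and let $p \in \mathbb{R}^n$ be an initial value. Run the original RCMC procedure (described in the context) on $K$, $\pi$, $p$ and an end time $t_{\max} \ge 0$. Then for every $k$ for which $q^{(k)}$ is output, $q^{(k)} = Vp$, where $V$ is the matrix of Type A with respect to $(S^{(k)}, T^{(k)})$.
   Context: $[n] = \{1,\dotsc,n\}$. $\Delta_n^\circ = \{y \in \mathbb{R}_{>0}^n : \sum_i y_i = 1\}$. A rate constant matrix with stationary distribution $\pi \in \Delta_n^\circ$ is a matrix $K \in \mathbb{R}^{n\times n}$ such that $K_{ij} \ge 0$ for $i \ne j$, every column of $K$ sums to $0$, and $K_{ij}\pi_j = K_{ji}\pi_i$ for all $i,j$. $A_{IJ}$ is the submatrix of $A$ with rows $I$ and columns $J$, and $K_{SS}^{-1}=(K_{SS})^{-1}$. Type A matrix: for a partition $[n] = S \sqcup T$ with $K_{SS}$ nonsingular, let $M := I_T + K_{TS}K_{SS}^{-2}K_{ST}$, $V_{TT} := \mathrm{diag}(\mathbf{1}_T^\top M)^{-1}$ ($\mathbf{1}_T$ the all-one vector in $\mathbb{R}^T$), and, with blocks ordered $S,T$, $$V = \begin{pmatrix} K_{SS}^{-1} K_{ST} V_{TT} K_{TS} K_{SS}^{-1} & -K_{SS}^{-1} K_{ST} V_{TT} \\ -V_{TT} K_{TS} K_{SS}^{-1} & V_{TT} \end{pmatrix};$$ for $S = \emptyset$ this reads $V = I_n$. ($K_{S^{(k)}S^{(k)}}$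 is nonsingular for all $k$ reached by the procedure below.) Original RCMC procedure: output $t^{(0)} := 0$, $q^{(0)} := p$; set $S^{(0)} = \emptyset$, $T^{(0)} = [n]$, $\Omega^{(0)} = I_n$, $p^{(0)} = p$, $K^{(0)} = K$. For $k = 1,2,\dotsc$: (1) choose $(i^{(k)}, j^{(k)})$ maximizing $K^{(k-1)}_{ij}$ over $i,j \in T^{(k-1)}$, $i \ne j$; (2) set $t^{(k)} := 1/K^{(k-1)}_{i^{(k)}j^{(k)}}$ (read as $+\infty$ if this entry is $0$); stop if $t^{(k)} > t_{\max}$, or if no pair $(i,j)$ exists; (3) $S^{(k)} := S^{(k-1)} \cup \{j^{(k)}\}$, $T^{(k)} := T^{(k-1)} \setminus \{j^{(k)}\}$, and $\sigma^{(k)} := 1/\sum_{i \in T^{(k)}} K^{(k-1)}_{ij^{(k)}}$; (4) $\Omega^{(k)}_{ij} := \Omega^{(k-1)}_{ij} + \sigma^{(k)} K^{(k-1)}_{ij^{(k)}} \Omega^{(k-1)}_{j^{(k)}j}$ for $i \in T^{(k)}$, $j \in [n]$; (5) $p^{(k)}_i := p^{(k-1)}_i + \sigma^{(k)} K^{(k-1)}_{ij^{(k)}} p^{(k-1)}_{j^{(k)}}$ for $i \in T^{(k)}$; (6) output $t^{(k)}$ and $q^{(k)} \in \mathbb{R}^n$ with $q^{(k)}_j := \sum_{i \in T^{(k)}} p^{(k)}_i \dfrac{\Omega^{(k)}_{ij}\pi_j}{\sum_{l=1}^n \Omega^{(k)}_{il}\pi_l}$ for $j \in [n]$; (7) $K^{(k)}_{ij}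 := \dfrac{K^{(k-1)}_{ij} + \sigma^{(k)} K^{(k-1)}_{ij^{(k)}} K^{(k-1)}_{j^{(k)}j}}{1 + \sigma^{(k)} K^{(k-1)}_{j^{(k)}j}}$ for $i,j \in T^{(k)}$. *)

(* Defs.v *)
From mathcomp Require Import all_boot all_order all_algebra.
From mathcomp Require Import constructive_ereal reals.

Set Implicit Arguments.
Unset Strict Implicit.
Unset Printing Implicit Defensive.

Import Order.TTheory GRing.Theory Num.Theory.

Local Open Scope ring_scope.

Section RateConstantMatrices.
Variables (R : realType) (n : nat).
Implicit Types (K : 'M[R]_n) (pi : 'cV[R]_n) (S I J : {set 'I_n}).

Definition open_simplex pi : Prop :=
  (forall i, 0 < pi i 0) /\ \sum_i pi i 0 = 1.

Definition rate_constant_matrix K pi : Prop :=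
  [/\ open_simplex pi,
      forall i j, i != j -> 0 <= K i j,
      forall j, \sum_i K i j = 0
    & forall i j, K i j * pi j 0 = K j i * pi i 0].

(* The submatrix A_{IJ}; the elements of I and J are listed in increasing
   order by enum_val. *)
Definition sub I J (A : 'M[R]_n) : 'M[R]_(#|I|, #|J|) :=
  mxsub (@enum_val _ (mem I)) (@enum_val _ (mem J)) A.

(* The matrix of the inclusion of R^I into R^n. *)
Definition incl I : 'M[R]_(n, #|I|) :=
  \matrix_(i, a) (i == enum_val a)%:R.

(* The n x n matrix with the given blocks with respect to the partition of the
   index set into S and its complement; see sub_glue. *)
Definition glue S (B11 : 'M[R]_(#|S|, #|S|)) (B12 : 'M[R]_(#|S|, #|~: S|))
    (B21 : 'M[R]_(#|~: S|, #|S|)) (B22 : 'M[R]_(#|~: S|, #|~: S|)) : 'M[R]_n :=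
  incl S *m B11 *m (incl S)^T + incl S *m B12 *m (incl (~: S))^T
  + incl (~: S) *m B21 *m (incl S)^T + incl (~: S) *m B22 *m (incl (~: S))^T.

Lemma sub_incl I J A : sub I J A = (incl I)^T *m A *m incl J.
Proof.
apply/matrixP => a b; rewrite !mxE (bigD1 (enum_val b)) //= big1 => [|j jb].
  rewrite !mxE eqxx mulr1 addr0 (bigD1 (enum_val a)) //= big1 => [|i ia].
    by rewrite !mxE eqxx mul1r addr0.
  by rewrite !mxE (negbTE ia) mul0r.
by rewrite !mxE (negbTE jb) mulr0.
Qed.

Lemma incl_id I : (incl I)^T *m incl I = 1%:M.
Proof.
apply/matrixP => a b; rewrite !mxE (bigD1 (enum_val a)) //= big1 => [|i ia].
  by rewrite !mxE eqxx mul1r addr0 (inj_eq enum_val_inj).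
by rewrite !mxE (negbTE ia) mul0r.
Qed.

Lemma incl_disj I J : [disjoint I & J] -> (incl I)^T *m incl J = 0.
Proof.
move=> dIJ; apply/matrixP => a b; rewrite !mxE big1 // => i _.
rewrite !mxE; case: eqP => [->|_]; last by rewrite mul0r.
case: eqP => [e|_]; last by rewrite mulr0.
by have := disjointFr dIJ (enum_valP a); rewrite e (enum_valP b).
Qed.

Lemma sub_glue S B11 B12 B21 B22 :
  let V := @glue S B11 B12 B21 B22 in
  [/\ sub S S V = B11, sub S (~: S) V = B12,
      sub (~: S) S V = B21 & sub (~: S) (~: S) V = B22].
Proof.
have d1 : [disjoint S & ~: S] by rewrite -setI_eq0 setICr.
have d2 : [disjoint ~: S & S] by rewrite disjoint_sym.
rewrite /glue; split; rewrite sub_incl !mulmxDr !mulmxDl !mulmxA;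
  rewrite !(incl_id, incl_disj d1, incl_disj d2) ?(mul0mx, mul1mx);
  rewrite -!mulmxA !(incl_id, incl_disj d1, incl_disj d2);
  by rewrite ?(mul0mx, mulmx0, mulmx1, addr0, add0r).
Qed.

(* The matrix V of Type A with respect to (S, ~: S). It is meaningful when
   sub S S K is a unit. *)
Definition typeA K S : 'M[R]_n :=
  let T := ~: S in
  let KSS' := invmx (sub S S K) in
  let KST := sub S T K in
  let KTS := sub T S K in
  let M : 'M[R]_#|T| := 1%:M + KTS *m (KSS' *m KSS') *m KST in
  let VTT := invmx (diag_mx ((const_mx 1 : 'rV[R]_#|T|) *m M)) in
  glue (KSS' *m KST *m VTT *m KTS *m KSS') (- (KSS' *m KST *m VTT))
       (- (VTT *m KTS *m KSS')) VTT.

(* T^(k) is the complement of S^(k). The procedure defines Omega^(k) and p^(k)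
   only on rows in T^(k), and K^(k) only on T^(k) x T^(k); the remaining
   entries are set to 0 after each step and are never read. *)
Record rcmc_state := RcmcState {
  stS : {set 'I_n};
  stOmega : 'M[R]_n;
  stp : 'cV[R]_n;
  stK : 'M[R]_n
}.

Definition stT (s : rcmc_state) : {set 'I_n} := ~: stS s.

Definition rcmc_init K (p : 'cV[R]_n) : rcmc_state :=
  RcmcState set0 1%:M p K.

(* A maximizing pair need not be unique: any one may be chosen. *)
Definition rcmc_pivot (s : rcmc_state) (i j : 'I_n) : Prop :=
  [/\ i \in stT s, j \in stT s, i != j
    & forall i' j', i' \in stT s -> j' \in stT s -> i' != j' ->
        stK s i' j' <= stK s i j].

Definition rcmc_time (s : rcmc_state) (i j : 'I_n) : \bar R :=
  if stK s i j == 0 then +oo%E else ((stK s i j)^-1)%:E.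

Definition rcmc_step (s : rcmc_state) (j0 : 'I_n) : rcmc_state :=
  let S' := j0 |: stS s in
  let T' := stT s :\ j0 in
  let K := stK s in
  let sigma := (\sum_(i in T') K i j0)^-1 in
  RcmcState S'
    (\matrix_(i, j) if i \in T'
       then stOmega s i j + sigma * K i j0 * stOmega s j0 j else 0)
    (\col_i if i \in T'
       then stp s i 0 + sigma * K i j0 * stp s j0 0 else 0)
    (\matrix_(i, j) if (i \in T') && (j \in T')
       then (K i j + sigma * K i j0 * K j0 j) / (1 + sigma * K j0 j) else 0).

Definition rcmc_q pi (s : rcmc_state) : 'cV[R]_n :=
  \col_j \sum_(i in stT s)
    stp s i 0 * (stOmega s i j * pi j 0 / \sum_l stOmega s i l * pi l 0).

(* rcmc_output K pi p tmax k s t q: some run of the procedure performs its k-th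
   step, reaching the state s = (S^(k), Omega^(k), p^(k), K^(k)), and there
   outputs t^(k) = t and q^(k) = q. *)
Inductive rcmc_output K pi (p : 'cV[R]_n) (tmax : R) :
    nat -> rcmc_state -> \bar R -> 'cV[R]_n -> Prop :=
| rcmc_output0 : rcmc_output K pi p tmax 0 (rcmc_init K p) 0%E p
| rcmc_outputS k s t q i j :
    rcmc_output K pi p tmax k s t q ->
    rcmc_pivot s i j ->
    (rcmc_time s i j <= tmax%:E)%E ->
    rcmc_output K pi p tmax k.+1 (rcmc_step s j) (rcmc_time s i j)
      (rcmc_q pi (rcmc_step s j)).

End RateConstantMatrices.

(* Main.v *)
Require Import Defs.
From mathcomp Require Import all_boot all_order all_algebra.
From mathcomp Require Import constructive_ereal reals.
From mathcomp Require Import ring.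

(** After step k write Om = Omega^(k)_{T,[n]}.  The procedure is Gaussian
elimination, so Om = (- K_TS K_SS^-1, I_T); hence Om K vanishes on the columns in S,
and its block L on T is the Schur complement of K_SS.  Detailed balance makes
L diag(pi_T) symmetric and turns diag(pi) Om^T diag(pi_T)^-1 into
P = (- K_SS^-1 K_ST; I_T).  Since the columns of Om sum to 1 and M = Om P,
the row 1^T M has entries d_j = (Om pi)_j / pi_j, the matrix K^(k) is
L diag(d)^-1, and V = P diag(d)^-1 Om, which is the formula defining q^(k). *)

Set Implicit Arguments.
Unset Strict Implicit.
Unset Printing Implicit Defensive.

Import Order.TTheory GRing.Theory Num.Theory.
Local Open Scope ring_scope.

(** * Inclusion matrices and nonsingular principal blocks *)

Section Inclusions.
Context {R : realType} {n : nat}.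
Implicit Types (S I J : {set 'I_n}) (A K : 'M[R]_n).

Lemma incl_mul_trE I i j :
  (incl R I *m (incl R I)^T) i j = ((i \in I) && (i == j))%:R.
Proof.
rewrite !mxE; have [iI|iI] /= := boolP (i \in I); last first.
  rewrite big1 // => a _; rewrite !mxE; case: eqP => [e|_]; last by rewrite mul0r.
  by rewrite e enum_valP in iI.
rewrite (bigD1 (enum_rank_in iI i)) //= !mxE enum_rankK_in // eqxx mul1r.
rewrite big1 ?addr0 => [|a ai]; first by rewrite eq_sym.
rewrite !mxE; case: eqP => [e|_]; last by rewrite mul0r.
by case/eqP: ai; rewrite -(enum_valK_in iI a) -e.
Qed.

(** Inserting this resolution of the identity into a product splits it into its blocks over S and
    T. *)
Lemma incl_partition S :
  incl R S *m (incl R S)^T + incl R (~: S) *m (incl R (~: S))^T = 1%:M.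
Proof.
apply/matrixP => i j; rewrite mxE !incl_mul_trE mxE inE.
by case: (i \in S); rewrite /= ?addr0 ?add0r.
Qed.

Lemma trincl_mulE m I (A : 'M[R]_(n, m)) a j :
  ((incl R I)^T *m A) a j = A (enum_val a) j.
Proof.
rewrite !mxE (bigD1 (enum_val a)) //= !mxE eqxx mul1r big1 ?addr0 // => i ia.
by rewrite !mxE (negbTE ia) mul0r.
Qed.

Lemma mul_inclE m I (A : 'M[R]_(m, n)) i a :
  (A *m incl R I) i a = A i (enum_val a).
Proof.
rewrite !mxE (bigD1 (enum_val a)) //= !mxE eqxx mulr1 big1 ?addr0 // => j ja.
by rewrite !mxE (negbTE ja) mulr0.
Qed.

(** A kernel vector of the block, extended by zero, is a vector of R^n supported on S, so the kernel
    can be tested without enumerating S. *)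
Lemma sub_unitmx S K :
  (forall v : 'cV[R]_n, (forall i, i \notin S -> v i 0 = 0) ->
     (forall i, i \in S -> (K *m v) i 0 = 0) -> v = 0) ->
  sub S S K \in unitmx.
Proof.
(* [kermx] is a left kernel; the transpose is taken so that column vectors are tested. *)
move=> kerK; rewrite -unitmx_tr -row_free_unit -kermx_eq0; apply/rowV0P => w /sub_kermxP wK.
have Kw : sub S S K *m w^T = 0 by rewrite -[LHS]trmxK trmx_mul trmxK wK trmx0.
suff v0 : incl R S *m w^T = 0.
  by rewrite -[w]trmxK -[w^T]mul1mx -(incl_id R S) -mulmxA v0 mulmx0 trmx0.
apply: kerK => i iS.
  rewrite mxE big1 // => a _; rewrite !mxE; case: eqP => [e|_]; last by rewrite mul0r.
  by rewrite e enum_valP in iS.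
have := congr1 (fun X : 'cV[R]_#|S| => X (enum_rank_in iS i) 0) Kw.
by rewrite /= sub_incl -!mulmxA trincl_mulE enum_rankK_in // => ->; rewrite mxE.
Qed.

End Inclusions.

(** * The invariant of the elimination *)

Lemma in_stT {R : realType} {n : nat} (s : rcmc_state R n) i :
  (i \in stT s) = (i \notin stS s).
Proof. exact: in_setC. Qed.

(** [inv_ker] expresses nonsingularity of K_SS through vectors supported on S. [inv_K] is K^(k) = L
    diag(d)^-1 with denominators cleared. Only rows in T are constrained, since a step sets the
    others to 0. *)
Record rcmc_invariant {R : realType} {n : nat} (K : 'M[R]_n) (pi p : 'cV[R]_n)
    (s : rcmc_state R n) : Prop := {
  inv_ker : forall v : 'cV[R]_n, (forall i, i \in stT s -> v i 0 = 0) ->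
    (forall i, i \in stS s -> (K *m v) i 0 = 0) -> v = 0;
  inv_Omega_id : forall i j, i \in stT s -> j \in stT s ->
    stOmega s i j = (i == j)%:R;
  inv_Omega_ge0 : forall i j, i \in stT s -> 0 <= stOmega s i j;
  inv_Omega_sum : forall j, \sum_(i in stT s) stOmega s i j = 1;
  inv_OmegaK : forall i j, i \in stT s -> j \in stS s ->
    (stOmega s *m K) i j = 0;
  inv_p : forall i, i \in stT s -> stp s i 0 = (stOmega s *m p) i 0;
  inv_K_ge0 : forall i j, i \in stT s -> j \in stT s -> i != j ->
    0 <= stK s i j;
  inv_K : forall i j, i \in stT s -> j \in stT s ->
    stK s i j * (stOmega s *m pi) j 0 = (stOmega s *m K) i j * pi j 0
}.

Section Invariant.
Context {R : realType} {n : nat} {K : 'M[R]_n} {p pi : 'cV[R]_n}.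
Hypothesis hK : rate_constant_matrix K pi.

Let pi_gt0 i : 0 < pi i 0. Proof. by case: hK => -[]. Qed.
Let K_ge0 i j : i != j -> 0 <= K i j. Proof. by case: hK => _ + _ _; apply. Qed.
Let K_sum j : \sum_i K i j = 0. Proof. by case: hK. Qed.
Let K_bal i j : K i j * pi j 0 = K j i * pi i 0. Proof. by case: hK. Qed.

Lemma rcmc_invariant_init : rcmc_invariant K pi p (rcmc_init K p).
Proof.
have T0 : stT (rcmc_init K p) = setT by rewrite /stT setC0.
split; rewrite ?T0 /=.
- by move=> v v0 _; apply/colP => i; rewrite v0 ?mxE ?inE.
- by move=> i j _ _; rewrite mxE.
- by move=> i j _; rewrite mxE ler0n.
- move=> j; rewrite (bigD1 j) ?inE //= mxE eqxx big1 ?addr0 // => i /andP[_ ij].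
  by rewrite mxE (negbTE ij).
- by move=> i j _; rewrite inE.
- by move=> i _; rewrite mul1mx.
- by move=> i j _ _; apply: K_ge0.
- by move=> i j _ _; rewrite !mul1mx.
Qed.

(** * Consequences of the invariant *)

Section State.
Context {s : rcmc_state R n}.
Hypothesis hs : rcmc_invariant K pi p s.

Lemma Omega_pi_gt0 i : i \in stT s -> 0 < (stOmega s *m pi) i 0.
Proof.
move=> iT; rewrite mxE (bigD1 i) //= (inv_Omega_id hs) // eqxx mul1r.
apply: ltr_wpDr => //; apply: sumr_ge0 => l _.
by rewrite mulr_ge0 ?(inv_Omega_ge0 hs) // ltW.
Qed.

(* Both sides are entries of Omega K diag(pi) Omega^T. *)
Lemma OmegaK_balance i j : i \in stT s -> j \in stT s ->
  (stOmega s *m K) i j * pi j 0 = (stOmega s *m K) j i * pi i 0.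
Proof.
have E a b : a \in stT s -> b \in stT s ->
  (stOmega s *m K) a b * pi b 0 =
  \sum_l \sum_m stOmega s a m * (K m l * pi l 0) * stOmega s b l.
  move=> aT bT; transitivity (\sum_l (stOmega s *m K) a l * pi l 0 * stOmega s b l).
    (* Only l = b survives: Omega K vanishes on columns in S, and Omega is the identity on T. *)
    rewrite (bigD1 b) //= (inv_Omega_id hs) // eqxx mulr1 big1 ?addr0 // => l lb.
    have [lS|lS] := boolP (l \in stS s); first by rewrite (inv_OmegaK hs) // !mul0r.
    by rewrite (inv_Omega_id hs) // ?in_stT // eq_sym (negbTE lb) mulr0.
  apply: eq_bigr => l _; rewrite mxE !mulr_suml; apply: eq_bigr => m _; ring.
move=> iT jT; rewrite !E // exchange_big /=.
apply: eq_bigr => l _; apply: eq_bigr => m _; rewrite K_bal; ring.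
Qed.

Lemma OmegaK_sum j : \sum_(i in stT s) (stOmega s *m K) i j = 0.
Proof.
rewrite -[RHS](K_sum j); under eq_bigr do rewrite mxE.
rewrite exchange_big /=; apply: eq_bigr => l _.
by rewrite -mulr_suml (inv_Omega_sum hs) mul1r.
Qed.

(** On T, each column of [stK s] is a positive multiple of that of Omega K, whose sum is 0. Hence
    the diagonal entry of the pivot column is -1/sigma. *)
Lemma stK_sum j : j \in stT s -> \sum_(i in stT s) stK s i j = 0.
Proof.
move=> jT; apply: (mulIf (lt0r_neq0 (Omega_pi_gt0 jT))).
rewrite mul0r mulr_suml; under eq_bigr do rewrite (inv_K hs) //.
by rewrite -mulr_suml OmegaK_sum mul0r.
Qed.

(** * Preservation of the invariant by one elimination step *)

Section Step.
Context {j0 : 'I_n}.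
Hypothesis j0T : j0 \in stT s.
Hypothesis pivot_gt0 : 0 < \sum_(i in stT s :\ j0) stK s i j0.

Let sigma := (\sum_(i in stT s :\ j0) stK s i j0)^-1.
Let sigma_gt0 : 0 < sigma. Proof. by rewrite invr_gt0. Qed.

Let T' := stT s :\ j0.
Let s' := rcmc_step s j0.

Lemma stT_step : stT (rcmc_step s j0) = stT s :\ j0.
Proof. by rewrite /stT /= setCU setIC setDE. Qed.

Let T'T i : i \in T' -> i \in stT s. Proof. by case/setD1P. Qed.
Let T'j0 i : i \in T' -> i != j0. Proof. by case/setD1P. Qed.

Let stK_pivot : sigma * stK s j0 j0 = -1.
Proof.
have := stK_sum j0T; rewrite (big_setD1 j0) //= => /eqP; rewrite addr_eq0 => /eqP->.
by rewrite mulrN mulVf // lt0r_neq0.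
Qed.

Let stOmega_step i j : i \in T' ->
  stOmega s' i j = stOmega s i j + sigma * stK s i j0 * stOmega s j0 j.
Proof. by move=> iT; rewrite mxE iT. Qed.

Let mul_stOmega_step m (A : 'M[R]_(n, m)) i j : i \in T' ->
  (stOmega s' *m A) i j =
  (stOmega s *m A) i j + sigma * stK s i j0 * (stOmega s *m A) j0 j.
Proof.
move=> iT; rewrite !mxE mulr_sumr -big_split /=; apply: eq_bigr => l _.
rewrite stOmega_step //; ring.
Qed.

Let OmegaK_pivot : (stOmega s *m K) j0 j0 != 0.
Proof.
apply/eqP => L0; have := inv_K hs j0T j0T; rewrite L0 mul0r => /eqP.
rewrite mulf_eq0 (gt_eqF (Omega_pi_gt0 j0T)) orbF => /eqP K0.
by have /eqP := stK_pivot; rewrite K0 mulr0 eq_sym oppr_eq0 oner_eq0.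
Qed.

(* sigma * stK i j0 is minus the multiplier of Gaussian elimination: the weights
   (Omega pi)_j / pi_j carried by stK cancel. *)
Let multiplier i : i \in stT s ->
  sigma * stK s i j0 * (stOmega s *m K) j0 j0 = - (stOmega s *m K) i j0.
Proof.
move=> iT; apply: (mulIf (lt0r_neq0 (pi_gt0 j0))).
rewrite mulNr -(inv_K hs iT j0T) -(mulrA (sigma * _)) -(inv_K hs j0T j0T).
by rewrite mulrACA stK_pivot mulN1r.
Qed.

Lemma rcmc_invariant_step : rcmc_invariant K pi p s'.
Proof.
split; rewrite ?stT_step -/T'.
- move=> v v0 Kv0; have vj0 : v j0 0 = 0.
    apply: (mulfI OmegaK_pivot); rewrite mulr0.
    (* Evaluate row j0 of Omega K v in two ways: as (Omega K) v it is the pivot times v_j0, as Omega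
       (K v) it is 0, because row j0 of Omega lives on S and j0, where K v vanishes. *)
    transitivity ((stOmega s *m K *m v) j0 0).
      rewrite [RHS]mxE (bigD1 j0) //= big1 ?addr0 // => l lj0.
      have [lS|lS] := boolP (l \in stS s); first by rewrite (inv_OmegaK hs) // mul0r.
      by rewrite v0 ?mulr0 // in_setD1 lj0 in_stT.
    rewrite -mulmxA mxE big1 // => l _.
    have [lS|] := boolP (l \in stS s'); first by rewrite Kv0 // mulr0.
    rewrite !inE negb_or => /andP[lj0 lS].
    by rewrite (inv_Omega_id hs) // ?in_stT // eq_sym (negbTE lj0) mul0r.
  apply: (inv_ker hs) => i iT; last by rewrite Kv0 // !inE iT orbT.
  by have [->//|ij0] := eqVneq i j0; rewrite v0 // in_setD1 ij0.
- move=> i j iT jT; rewrite stOmega_step // !(inv_Omega_id hs) // ?T'T //.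
  by rewrite [j0 == j]eq_sym (negbTE (T'j0 jT)) mulr0 addr0.
- move=> i j iT; rewrite stOmega_step // addr_ge0 ?mulr_ge0 ?(inv_Omega_ge0 hs) // ?T'T //.
    exact: ltW.
  by rewrite (inv_K_ge0 hs) // ?T'T ?T'j0.
- move=> j; rewrite (eq_bigr _ (fun i iT => stOmega_step j iT)) big_split /=.
  (* Row j0 is distributed over T' with weights sigma K_{i j0} of total 1, so column sums are
     kept. *)
  rewrite -mulr_suml -mulr_sumr mulVf ?lt0r_neq0 // mul1r addrC.
  by rewrite -[RHS](inv_Omega_sum hs j) [RHS](big_setD1 j0).
- move=> i j iT; rewrite mul_stOmega_step //.
  case/setU1P => [->|jS]; first by rewrite multiplier // ?T'T // subrr.
  by rewrite !(inv_OmegaK hs) // ?T'T // mulr0 addr0.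
- by move=> i iT; rewrite mul_stOmega_step // mxE iT !(inv_p hs) // ?T'T.
- move=> i j iT jT ij; rewrite mxE iT jT /=.
  have Kj : 0 <= stK s j0 j by rewrite (inv_K_ge0 hs) // ?T'T // eq_sym T'j0.
  have Ki : 0 <= stK s i j0 by rewrite (inv_K_ge0 hs) // ?T'T ?T'j0.
  have Kij : 0 <= stK s i j by rewrite (inv_K_ge0 hs) // ?T'T.
  have s0 := ltW sigma_gt0.
  by rewrite divr_ge0 ?addr_ge0 ?mulr_ge0.
- move=> i j iT jT; rewrite mxE iT jT /= !mul_stOmega_step //.
  have Kj : 0 <= stK s j0 j by rewrite (inv_K_ge0 hs) // ?T'T // eq_sym T'j0.
  have d0 : 1 + sigma * stK s j0 j != 0.
    by rewrite lt0r_neq0 // ltr_pwDl // mulr_ge0 // ltW.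
  (* By this balance the new (Omega pi)_j is the old one times 1 + sigma K_{j0 j}, exactly the
     denominator in the update of K. *)
  have bal : stK s j j0 * (stOmega s *m pi) j0 0 = stK s j0 j * (stOmega s *m pi) j 0.
    by rewrite !(inv_K hs) // ?T'T // OmegaK_balance // ?T'T.
  rewrite -[sigma * _ * (stOmega s *m pi) j0 0]mulrA bal.
  have -> w : w + sigma * (stK s j0 j * w) = (1 + sigma * stK s j0 j) * w by ring.
  by rewrite mulrA divfK // !mulrDl -!(mulrA (sigma * stK s i j0)) !(inv_K hs) // ?T'T.
Qed.
End Step.

(** A zero pivot has time +oo, beyond [tmax]; so the pivot of a performed step is positive, and the
    other summands are nonnegative. *)
Lemma pivot_sum_gt0 i j (tmax : R) :
  rcmc_pivot s i j -> (rcmc_time s i j <= tmax%:E)%E ->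
  0 < \sum_(l in stT s :\ j) stK s l j.
Proof.
move=> [iT jT ij _]; rewrite /rcmc_time; case: eqP => // /eqP Kij _.
rewrite (big_setD1 i) /= ?in_setD1 ?ij //; apply: ltr_pwDl.
  by rewrite lt_def Kij (inv_K_ge0 hs).
by apply: sumr_ge0 => l /setD1P[_ /setD1P[lj lT]]; rewrite (inv_K_ge0 hs).
Qed.

Lemma sub_unitmx_invariant : sub (stS s) (stS s) K \in unitmx.
Proof.
apply: sub_unitmx => v v0 Kv0; apply: (inv_ker hs) => // i.
by rewrite in_stT => /v0.
Qed.

(** * Block formulas and the Type A matrix *)

Local Notation S := (stS s).
Local Notation T := (~: stS s).
Local Notation E_S := (incl R S).
Local Notation E_T := (incl R T).
Local Notation KSS' := (invmx (sub S S K)).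

Let Om := E_T^T *m stOmega s.
Let P := E_T - E_S *m KSS' *m sub S T K.

(** The identity block on T and the equation Om_S K_SS + K_TS = 0, solved by inverting K_SS,
    determine Om. *)
Let Omega_blocks : Om = E_T^T - sub T S K *m KSS' *m E_S^T.
Proof.
have OmT : Om *m E_T = 1%:M.
  apply/matrixP => a b; rewrite mul_inclE trincl_mulE mxE.
  by rewrite (inv_Omega_id hs) ?enum_valP // (inj_eq enum_val_inj).
have OmKS : Om *m K *m E_S = 0.
  apply/matrixP => a b; rewrite mul_inclE /Om -mulmxA trincl_mulE [RHS]mxE.
  by rewrite (inv_OmegaK hs) // ?enum_valP // -/(stT s) enum_valP.
have OmS : Om *m E_S = - (sub T S K *m KSS').
  apply/eqP; rewrite -addr_eq0 -(mulmxK sub_unitmx_invariant (Om *m E_S)).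
  rewrite -mulmxDl -[X in (X + _) *m _]mulmxA.
  suff -> : Om *m (E_S *m sub S S K) + sub T S K = 0 by rewrite mul0mx.
  rewrite -[RHS]OmKS -[in RHS](mulmx1 Om) -(incl_partition S).
  by rewrite mulmxDr !mulmxDl !mulmxA OmT !mul1mx !sub_incl !mulmxA.
rewrite -[Om]mulmx1 -(incl_partition S) mulmxDr !mulmxA OmT OmS mul1mx.
by rewrite mulNmx addrC.
Qed.

(* By detailed balance P = diag(pi) Om^T diag(pi_T)^-1. *)
Let P_entry i a : P i a = pi i 0 * stOmega s (enum_val a) i / pi (enum_val a) 0.
Proof.
pose Q : 'M[R]_(n, #|T|) :=
  \matrix_(i, a) (pi i 0 * stOmega s (enum_val a) i / pi (enum_val a) 0).
suff -> : P = Q by rewrite mxE.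
have TQ : E_T^T *m Q = 1%:M.
  apply/matrixP => b c; rewrite trincl_mulE !mxE.
  rewrite (inv_Omega_id hs) ?enum_valP // (inj_eq enum_val_inj) eq_sym.
  by case: eqP => [->|_]; rewrite ?mulr1 ?divff ?lt0r_neq0 // mulr0 mul0r.
(* Detailed balance transposes the vanishing of Omega K on columns in S into that of K Q on rows in
   S; with the identity block on T this determines Q. *)
have SKQ : E_S^T *m K *m Q = 0.
  apply/matrixP => b c; rewrite -mulmxA trincl_mulE [RHS]mxE mxE.
  transitivity (pi (enum_val b) 0 / pi (enum_val c) 0
      * (stOmega s *m K) (enum_val c) (enum_val b)).
    rewrite mxE mulr_sumr; apply: eq_bigr => l _; rewrite mxE !mulrA K_bal.
    ring.
  by rewrite (inv_OmegaK hs) ?enum_valP // mulr0.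
have SQ : E_S^T *m Q = - (KSS' *m sub S T K).
  apply/eqP; rewrite -addr_eq0 -(mulKmx sub_unitmx_invariant (_ *m Q)) -mulmxDr.
  suff -> : sub S S K *m (E_S^T *m Q) + sub S T K = 0 by rewrite mulmx0.
  rewrite -SKQ -[in RHS](mul1mx Q) -(incl_partition S).
  by rewrite mulmxDl !mulmxDr !mulmxA -!(mulmxA _ _ Q) TQ mulmx1 !sub_incl !mulmxA.
rewrite -[Q]mul1mx -(incl_partition S) mulmxDl -!mulmxA TQ SQ mulmx1.
by rewrite mulmxN !mulmxA addrC.
Qed.

Let d12 : [disjoint S & T]. Proof. by rewrite -setI_eq0 setICr. Qed.
Let d21 : [disjoint T & S]. Proof. by rewrite disjoint_sym. Qed.

Let mul_Omega_P : Om *m P = 1%:M + sub T S K *m (KSS' *m KSS') *m sub S T K.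
Proof.
rewrite Omega_blocks /P mulmxBl !mulmxBr !mulmxA !incl_id.
rewrite -!(mulmxA _ E_S^T) !incl_id !(incl_disj _ d12) !(incl_disj _ d21).
by rewrite !(mulmx1, mul0mx, mulmx0, subr0, sub0r) opprK.
Qed.

Let VTT_diag :
  invmx (diag_mx ((const_mx 1 : 'rV[R]_#|T|) *m (Om *m P))) =
  diag_mx (\row_a (pi (enum_val a) 0 / (stOmega s *m pi) (enum_val a) 0)).
Proof.
have Om1 : (const_mx 1 : 'rV[R]_#|T|) *m Om = const_mx 1.
  apply/rowP => j; rewrite !mxE -[RHS](inv_Omega_sum hs j) [RHS]big_enum_val /=.
  by apply: eq_bigr => a _; rewrite trincl_mulE mxE mul1r.
set d := _ *m (Om *m P).
have dE a : d 0 a = (stOmega s *m pi) (enum_val a) 0 / pi (enum_val a) 0.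
  rewrite /d mulmxA Om1 !mxE mulr_suml; apply: eq_bigr => i _.
  by rewrite mxE mul1r P_entry [pi i 0 * _]mulrC.
(* An explicit right inverse shows both that diag(d) is a unit and what [invmx] returns. *)
have dV : diag_mx d *m
    diag_mx (\row_a (pi (enum_val a) 0 / (stOmega s *m pi) (enum_val a) 0)) = 1%:M.
  rewrite mulmx_diag -diag_const_mx; congr diag_mx; apply/rowP => a.
  rewrite [LHS]mxE [X in _ * X]mxE [RHS]mxE dE.
  have w0 := lt0r_neq0 (Omega_pi_gt0 (enum_valP a)).
  by rewrite mulrA divfK ?divff // lt0r_neq0.
have [dU _] := mulmx1_unit dV.
by rewrite -[RHS]mul1mx -(mulVmx dU) -mulmxA dV mulmx1.
Qed.

(** The four blocks of V assemble into P V_TT Om. In P diag(d)^-1 the factors pi_a cancel, leaving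
    Omega_aj pi_j / (Omega pi)_a, and Om p is p^(k) on T. *)
Lemma rcmc_q_typeA : rcmc_q pi s = typeA K S *m p.
Proof.
have -> : typeA K S = P *m invmx (diag_mx (const_mx 1 *m (Om *m P))) *m Om.
  rewrite mul_Omega_P /typeA /glue; set V := invmx (diag_mx _).
  rewrite Omega_blocks /P mulmxBr !mulmxBl !mulmxA.
  rewrite !(mulmxN, mulNmx) !mulmxA.
  by rewrite opprB [LHS]addrC -!addrA; congr (_ + _); rewrite addrCA.
rewrite VTT_diag -!mulmxA; apply/colP => j; rewrite mxE [RHS]mxE [LHS]big_enum_val /=.
apply: eq_bigr => a _; have aT := enum_valP a; have w0 := lt0r_neq0 (Omega_pi_gt0 aT).
have -> : \sum_l stOmega s (enum_val a) l * pi l 0 = (stOmega s *m pi) (enum_val a) 0.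
  by rewrite mxE.
rewrite mul_diag_mx [X in _ = _ * X]mxE [X in _ = _ * (X * _)]mxE.
rewrite trincl_mulE P_entry (inv_p hs) //.
by field; rewrite w0 lt0r_neq0.
Qed.
End State.

(** * Induction along a run *)

Lemma rcmc_output_invariant {tmax k s t q} :
  rcmc_output K pi p tmax k s t q ->
  rcmc_invariant K pi p s /\ q = rcmc_q pi s.
Proof.
elim=> [|{}k {}s {}t {}q i j _ [hs _] pivot time].
  split; first exact: rcmc_invariant_init.
  (* The initial output is p by definition; the formula for later outputs also gives p when Omega =
     I. *)
  apply/colP => j; rewrite mxE (bigD1 j) ?in_stT ?inE //= [X in _ + X]big1 => [|i /andP[_ ij]].
    have -> : \sum_l (1%:M : 'M[R]_n) j l * pi l 0 = pi j 0.
      by rewrite -[in RHS](mul1mx pi) mxE.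
    rewrite addr0 mxE eqxx mul1r.
    by rewrite divff ?mulr1 // lt0r_neq0.
  by rewrite mxE (negbTE ij) !mul0r mulr0.
split=> //; have [_ jT _ _] := pivot.
exact: rcmc_invariant_step (pivot_sum_gt0 hs pivot time).
Qed.
End Invariant.

Theorem theoremB3 (R : realType) (n : nat) (K : 'M[R]_n) (pi p : 'cV[R]_n)
    (tmax : R) (hK : rate_constant_matrix K pi) (htmax : 0 <= tmax)
    (k : nat) (s : rcmc_state R n) (t : \bar R) (q : 'cV[R]_n)
    (hq : rcmc_output K pi p tmax k s t q) :
  sub (stS s) (stS s) K \in unitmx /\ q = typeA K (stS s) *m p.
Proof.
have [hs ->] := rcmc_output_invariant hK hq.
by split; [exact: (sub_unitmx_invariant hs) | exact: (rcmc_q_typeA hK hs)].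
Qed.
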